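(* Let $F$ be an algebraically closed field of characteristic $2$, and let $n$ be an even positive integer which is not a power of $2$. Let $D$ be the natural simple $F\mathfrak{S}_n$-module and let $P_n$ be a Sylow $2$-subgroup of $\mathfrak{S}_n$. Then $D$ has vertex $P_n$ and source $\mathrm{Res}_{P_n}^{\mathfrak{S}_n}(D)$.
   Context: $\mathfrak{S}_n$ denotes the symmetric group on $\{1,\ldots,n\}$. The natural simple $F\mathfrak{S}_n$-module $D=D^{(n-1,1)}$ is the unique non-trivial composition factor of the natural permutation $F\mathfrak{S}_n$-module $M$ with permutation basis $\{\gamma_1,\ldots,\gamma_n\}$. For $n$ even, $D=M'/M''$, where $M'=\{\sum_i a_i\gamma_i\mid \sum_i a_i=0\}$ and $M''=\langle\sum_i\gamma_i\rangle_F$, so $\dim D=n-2$. Modules are finitely generated right modules, and vertices and sources are in the sense of Green. *)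

(* Defs.v *)
From mathcomp Require Import all_boot all_algebra all_fingroup.
From mathcomp Require Import all_solvable all_character.

Set Implicit Arguments.
Unset Strict Implicit.
Unset Printing Implicit Defensive.

Import GroupScope GRing.Theory.
Local Open Scope ring_scope.

Section Modules.

Variables (F : fieldType) (gT : finGroupType) (G : {group gT}).

Definition mx_indecomposable n (rG : mx_representation F G n) : Prop :=
  (0 < n)%N /\
  forall U W : 'M[F]_n, mxmodule rG U -> mxmodule rG W ->
    (U + W :=: 1%:M)%MS -> mxdirect (U + W) -> U = 0 \/ W = 0.

Definition mx_dsummand n1 (rG1 : mx_representation F G n1)
    n2 (rG2 : mx_representation F G n2) : Prop :=
  exists (U W : 'M[F]_n2) (modU : mxmodule rG2 U),
    [/\ mxmodule rG2 W, (U + W :=: 1%:M)%MS, mxdirect (U + W)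
      & mx_rsim rG1 (submod_repr modU)].

End Modules.

Section Induced.

Variables (F : fieldType) (gT : finGroupType) (G H : {group gT}).
Hypothesis sHG : H \subset G.
Variables (m : nat) (rH : mx_representation F H m).

Definition transv (i : 'I_#|rcosets H G|) : gT := repr (enum_val i).

(* The module W (x)_{FH} FG is the direct sum of the W (x) r_i, where the r_i  *)
(* represent the right cosets of H in G, and (w (x) r_i) g is                  *)
(* w (r_i g r_j^-1) (x) r_j for the unique j such that r_i g \in H r_j.        *)
Definition induced_mx (g : gT) :=
  \mxblock_(i < #|rcosets H G|, j < #|rcosets H G|)
    (if (transv i * g * (transv j)^-1)%g \in H
     then rH (transv i * g * (transv j)^-1)%g else 0 : 'M[F]_m).

Lemma transv_in i : transv i \in G.
Proof.
have /rcosetsP[x Gx defx] := enum_valP i.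
have: transv i \in H :* x.
  by rewrite /transv defx mem_repr_rcoset.
by case/rcosetP=> h Hh ->; rewrite groupM // (subsetP sHG).
Qed.

Lemma rcoset_transv i : H :* transv i = enum_val i.
Proof.
have /rcosetsP[x Gx defx] := enum_valP i.
by rewrite /transv defx rcoset_repr.
Qed.

Lemma transv_eq i j :
  ((transv i * (transv j)^-1)%g \in H) = (i == j).
Proof.
rewrite -mem_rcoset; apply/idP/eqP => [Hij | ->]; last exact: rcoset_refl.
by apply: enum_val_inj; rewrite -!rcoset_transv; apply: rcoset_eqP.
Qed.

Lemma transv_mul k (a x y b : gT) :
  (a * (x * y) * b = (a * x * (transv k)^-1) * (transv k * y * b))%g.
Proof. by rewrite !mulgA mulgVK. Qed.

Lemma transv_quot (a b c : gT) :
  (b * c^-1 = (a * b^-1)^-1 * (a * c^-1))%g.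
Proof. by rewrite invMg invgK !mulgA mulgVK. Qed.

Lemma induced_mx_repr : mx_repr G induced_mx.
Proof.
split=> [|x y Gx Gy].
  rewrite -mxdiagZ; apply: eq_mxblock => i j.
  rewrite mulg1 transv_eq; case: eqVneq => // eq_ij.
  by subst j; rewrite conform_mx_id mulgV repr_mx1.
rewrite /induced_mx mul_mxblock; apply: eq_mxblock => i j.
have [k defk]: exists k, (transv i * x * (transv k)^-1)%g \in H.
  have Hc: H :* (transv i * x)%g \in rcosets H G.
    by rewrite mem_rcosets mulSGid // groupM // transv_in.
  exists (enum_rank_in Hc (H :* (transv i * x)%g)).
  rewrite -mem_rcoset rcoset_transv enum_rankK_in //; exact: rcoset_refl.
rewrite (bigD1 k) //= defk big1 ?addr0 => [|l neq_lk].
  rewrite (transv_mul k) groupMl //; case: ifP => [Hy|_]; last by rewrite mulmx0.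
  by rewrite repr_mxM.
rewrite ifF ?mul0mx //; apply: contraNF neq_lk => Hl.
by rewrite -transv_eq (transv_quot (transv i * x)%g) groupM ?groupV.
Qed.

Canonical induced_repr := MxRepresentation induced_mx_repr.

End Induced.

Section Green.

Variables (F : fieldType) (gT : finGroupType) (G : {group gT}).
Variables (n : nat) (rG : mx_representation F G n).

Definition rel_projective (H : {group gT}) (sHG : H \subset G) : Prop :=
  exists (m : nat) (rH : mx_representation F H m),
    mx_dsummand rG (induced_repr sHG rH).

Definition is_vertex (Q : {group gT}) (sQG : Q \subset G) : Prop :=
  [/\ mx_indecomposable rG, rel_projective sQG
    & forall (K : {group gT}) (sKQ : K \subset Q),
        rel_projective (subset_trans sKQ sQG) -> K :=: Q].

Definition has_vertex_source (Q : {group gT}) (sQG : Q \subset G)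
    m (rQ : mx_representation F Q m) : Prop :=
  [/\ is_vertex sQG, mx_indecomposable rQ
    & mx_dsummand rG (induced_repr sQG rQ)].

End Green.

Section Natural.

Variables (F : fieldType) (n : nat).

Lemma perm_mx_repr : mx_repr [set: 'S_n] (@perm_mx F n).
Proof. by split=> [|s t _ _]; [exact: perm_mx1 | exact: perm_mxM]. Qed.

(* The right action is gamma_i s = gamma_(s i), with gamma_i = delta_mx 0 i.   *)
Definition perm_repr : mx_representation F [set: 'S_n] n :=
  MxRepresentation perm_mx_repr.

Definition augmentation_mx : 'M[F]_n := kermx (const_mx 1 : 'cV[F]_n).

Definition trivial_line_mx : 'M[F]_n := <<(const_mx 1 : 'rV[F]_n)>>%MS.

Lemma augmentation_module : mxmodule perm_repr augmentation_mx.
Proof.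
apply/mxmoduleP => s _; apply/sub_kermxP.
have E: perm_mx s *m const_mx 1 = const_mx 1 :> 'cV[F]_n.
  by rewrite -row_permE; apply/matrixP => i j; rewrite !mxE.
by rewrite -mulmxA [perm_repr s]/(perm_mx s) E mulmx_ker.
Qed.

Lemma trivial_line_module : mxmodule perm_repr trivial_line_mx.
Proof.
apply/mxmoduleP => s _; rewrite (eqmxMr _ (genmxE _)) genmxE.
rewrite [perm_repr s]/(perm_mx s) -[s]invgK -col_permE.
suff ->: col_perm s^-1 (const_mx 1) = const_mx 1 :> 'rV[F]_n by [].
by apply/matrixP => i j; rewrite !mxE.
Qed.

Lemma trivial_line_sub :
  n%:R = 0 :> F -> (trivial_line_mx <= augmentation_mx)%MS.
Proof.
move=> n0; rewrite genmxE; apply/sub_kermxP/matrixP => i j; rewrite !mxE.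
under eq_bigr => k _ do rewrite !mxE mulr1.
by rewrite sumr_const card_ord.
Qed.

(* section_repr modU modV is (U + V) / U; when the characteristic divides n    *)
(* the line lies in the augmentation submodule M', and this is M' / M''.       *)
Definition natural_simple_repr :=
  section_repr trivial_line_module augmentation_module.

End Natural.

(* Main.v *)
(* In characteristic 2 a transposition t = (i j) acts on D as the transvection *)
(* 1 + f e, where e is the class of gamma_i + gamma_j.  As n is even, P        *)
(* contains a perfect matching of transpositions; each e lies in one of the    *)
(* two summands of a decomposition of Res_P D.  The e sum to zero, and a sum   *)
(* over a proper nonempty set of them is nonzero, so all of them lie in the    *)
(* same summand; the other one is then fixed by the matching, hence consists   *)
(* of combinations of the e, and so vanishes.                                  *)
(* If D were projective relative to K < P, then 1 = \sum_C a_C over the cosets *)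
(* C of K, permuted by P, and as End_P(D) is local the sum over some P-orbit   *)
(* is a unit.  That orbit sum is b + g^-1 b g for an endomorphism b over an    *)
(* index 2 subgroup R of P and any g in P \ R.  Since n is not a power of 2, P *)
(* is intransitive, hence generated by the centralisers of the transpositions  *)
(* in the matching, so g may be taken to commute with one of them, t.  If t is *)
(* in R, then e is fixed up to scalars by b and g, so e (b + g^-1 b g) = 0; if *)
(* not, then g = t makes b + g^-1 b g of rank at most 2 < dim D.  Neither is a *)
(* unit.                                                                       *)

Require Import Defs.
From mathcomp Require Import all_boot all_algebra all_fingroup.
From mathcomp Require Import all_solvable all_character.

Set Implicit Arguments.
Unset Strict Implicit.
Unset Printing Implicit Defensive.

Import GroupScope GRing.Theory.
Local Open Scope ring_scope.

(** * Relative projectivity *)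

(** The index of [P] is odd, hence invertible in [F], so D is a summand of the module induced from
    Res_P D ([dsummand_induced_restriction]). It remains to see that Res_P D is indecomposable
    ([natural_indecomposable]) and that D is projective relative to no proper subgroup of [P]. The
    latter is [vertex_of_transvections]. It turns relative projectivity into a decomposition of the
    identity indexed by cosets ([rel_projective_components]), and needs, for each maximal subgroup
    [R] of [P], a transvection t in [P] and an element of [P] outside [R] commuting with t. These
    come from [natural_transvection] and [Sylow2_generated_by_centralizers]; the latter is where n
    not being a power of 2 enters, through the intransitivity of [P]. *)

Lemma indecomposable_of_subg (F : fieldType) (gT : finGroupType) (G H : {group gT})
    (sHG : H \subset G) d (rG : mx_representation F G d) :
  mx_indecomposable (subg_repr rG sHG) -> mx_indecomposable rG.
Proof.
have sub (U : 'M_d) : mxmodule rG U -> mxmodule (subg_repr rG sHG) U.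
  by move/mxmoduleP=> modU; apply/mxmoduleP=> x Hx; apply/modU/(subsetP sHG).
by case=> d_gt0 indec; split=> // U W /sub modU /sub modW; apply: indec.
Qed.

Section RelativeProjectivity.

Variables (F : fieldType) (gT : finGroupType) (G : {group gT}).

Lemma mx_dsummandP n1 (rG1 : mx_representation F G n1)
    n2 (rG2 : mx_representation F G n2) :
  mx_dsummand rG1 rG2 <->
  exists (i : 'M_(n1, n2)) (p : 'M_(n2, n1)),
    [/\ i *m p = 1%:M, {in G, forall x, rG1 x *m i = i *m rG2 x}
      & {in G, forall x, rG2 x *m p = p *m rG1 x}].
Proof.
split=> [[U [W [modU [modW defUW dxUW [B en1]]]]] | [i [p [ip1 homi homp]]]].
  subst n1; rewrite row_free_unit => uB homB.
  have dx : (U :&: W = 0)%MS by apply/mxdirect_addsP.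
  exists (B *m val_submod 1%:M), (proj_mx U W *m in_submod U 1%:M *m invmx B).
  have homp x : x \in G ->
      rG2 x *m (proj_mx U W *m in_submod U 1%:M)
        = proj_mx U W *m in_submod U 1%:M *m submod_repr modU x.
    move=> Gx; rewrite mulmxA -!in_submodE -in_submodJ; last first.
      by rewrite -[proj_mx U W]mul1mx proj_mx_sub.
    congr in_submod; rewrite -[proj_mx U W in RHS]mul1mx -[rG2 x in LHS]mul1mx.
    apply: (hom_mxP _) x Gx.
    by apply: submx_trans (submx1 _) _; rewrite -defUW proj_mx_hom.
  split=> [|x Gx|x Gx].
  - have -> : B *m val_submod 1%:M *m (proj_mx U W *m in_submod U 1%:M *m invmx B)
        = B *m (val_submod 1%:M *m proj_mx U W *m in_submod U 1%:M) *m invmx B.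
      by rewrite -!mulmxA.
    rewrite proj_mx_id ?val_submod1 //.
    by rewrite -in_submodE val_submodK mulmx1 mulmxV.
  - have vJ : val_submod 1%:M *m rG2 x = submod_repr modU x *m val_submod 1%:M.
      by rewrite -val_submodE -(val_submodJ modU) // mul1mx.
    by rewrite -[RHS]mulmxA vJ [RHS]mulmxA -homB // -mulmxA.
  move: (proj_mx U W *m _) (homp x Gx) (homB x Gx) => q.
  move: (submod_repr modU x) => y homq homBx; rewrite mulmxA homq -!mulmxA.
  by congr (q *m _); rewrite -[RHS](mulmxK uB) -(mulmxA (invmx B)) homBx mulKmx.
(* Conversely, [p *m i] is an idempotent whose image is that of [i] and whose kernel is that of [p];
   these two submodules are the summands. *)
have free_i : row_free i by apply/row_freeP; exists p.
have ker_p : p *m i *m p = p by rewrite -mulmxA ip1 mulmx1.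
have modi : mxmodule rG2 <<i>>%MS.
  apply/mxmoduleP=> x Gx; rewrite (eqmxMr _ (genmxE i)) genmxE -homi //.
  exact: submxMl.
exists <<i>>%MS, (kermx p), modi; split.
- apply/mxmoduleP=> x Gx; apply/sub_kermxP.
  by rewrite -mulmxA homp // mulmxA mulmx_ker mul0mx.
- apply/eqmxP; rewrite submx1 /= -[1%:M](subrK (p *m i)) addrC.
  apply: addmx_sub_adds; first by rewrite genmxE submxMl.
  by apply/sub_kermxP; rewrite mulmxBl ker_p mul1mx subrr.
- apply/mxdirect_addsP/eqP; rewrite -submx0; apply/rV_subP=> v.
  rewrite sub_capmx genmxE => /andP[/submxP[w ->] /sub_kermxP].
  by rewrite -mulmxA ip1 mulmx1 => ->; rewrite mul0mx sub0mx.
have sub_i : (i <= <<i>>)%MS by rewrite genmxE.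
exists (in_submod <<i>>%MS i) => [||x Gx].
- by rewrite genmxE (eqP free_i).
- by rewrite /row_free mxrank_in_submod // (eqP free_i).
by rewrite -in_submodJ // -homi // ![in_submod _ (_ *m _)]in_submodE -mulmxA -in_submodE.
Qed.

Variables (H : {group gT}) (sHG : H \subset G).

Section Induction.

Variables (m : nat) (rH : mx_representation F H m).

(** The projection of the induced module onto its block at the coset [C]. Indexing by sets lets the
    group act on the index by plain right translation. *)
Definition induced_component (C : {set gT}) :=
  \mxdiag_(j < #|rcosets H G|) (if enum_val j == C then 1%:M else 0 : 'M[F]_m).

Lemma sum_induced_component :
  \sum_(C in rcosets H G) induced_component C = 1%:M.
Proof.
rewrite /induced_component -mxdiag_sum -mxdiagZ; apply: eq_mxdiag => j.
rewrite (bigD1 (enum_val j)) ?enum_valP //= eqxx big1 ?addr0 // => C.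
by case/andP=> _ neqC; rewrite eq_sym (negPf neqC).
Qed.

Lemma induced_componentJ C x : x \in G ->
  induced_component C *m induced_repr sHG rH x
    = induced_repr sHG rH x *m induced_component (C :* x).
Proof.
move=> Gx; rewrite mul_mxdiag_mxblock mul_mxblock_mxdiag.
apply: eq_mxblock => i j.
case Hij: ((transv i * x * (transv j)^-1)%g \in H); last first.
  by rewrite mulmx0 mul0mx.
have -> : (enum_val j == C :* x) = (enum_val i == C).
  rewrite -!rcoset_transv.
  have -> : H :* transv j = H :* transv i :* x.
    by rewrite -rcosetM; apply/esym/rcoset_eqP; rewrite mem_rcoset.
  by apply/eqP/eqP => [/rcoset_inj|->].
by case: ifP => _; rewrite ?mulmx1 ?mul1mx ?mulmx0 ?mul0mx.
Qed.

End Induction.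

(** This is the form of Higman's criterion used below: splitting D off the induced module carries
    the block projections to endomorphisms [a C] of D, which sum to the identity and are permuted by
    conjugation as the cosets are by translation. *)
Lemma rel_projective_components d (rG : mx_representation F G d) :
  rel_projective rG sHG ->
  exists2 a : {set gT} -> 'M[F]_d,
    \sum_(C in rcosets H G) a C = 1%:M
    & forall C x, x \in G -> a C *m rG x = rG x *m a (C :* x).
Proof.
case=> m [rH /mx_dsummandP[i [p [ip1 homi homp]]]].
exists (fun C => i *m induced_component m C *m p) => [|C x Gx].
  by rewrite -mulmx_suml -mulmx_sumr sum_induced_component mulmx1.
rewrite -[LHS]mulmxA -homp // -!mulmxA (mulmxA (induced_component m C)).
by rewrite induced_componentJ // !mulmxA homi.
Qed.

(** The splitting averages: v goes to the sum of the v r_j^-1 (x) r_j divided by the index, and w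
    (x) r_j goes back to w r_j. *)
Lemma dsummand_induced_restriction d (rG : mx_representation F G d) :
  #|G : H|%:R != 0 :> F ->
  mx_dsummand rG (induced_repr sHG (subg_repr rG sHG)).
Proof.
move=> nz_index; set N := #|rcosets H G|; have Gtr := @transv_in _ G H sHG.
(* Multiplication by [x] permutes the cosets, so each column of the induced matrix, and by [cosetE']
   each row, has a single block not set to zero. *)
have cosetE x (Gx : x \in G) (j : 'I_N) :
    exists i : 'I_N, forall k : 'I_N,
      ((transv k * x * (transv j)^-1)%g \in H) = (k == i).
  have Hc : H :* (transv j * x^-1)%g \in rcosets H G.
    by rewrite mem_rcosets mulSGid // groupM ?groupV // Gtr.
  exists (enum_rank_in Hc (H :* (transv j * x^-1)%g)) => k.
  have <- : ((transv k * (transv j * x^-1)^-1)%g \in H)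
           = ((transv k * x * (transv j)^-1)%g \in H).
    by rewrite invMg invgK mulgA.
  rewrite -mem_rcoset -(inj_eq enum_val_inj) enum_rankK_in //.
  rewrite -rcoset_transv; apply/idP/eqP => [/rcoset_eqP // | <-].
  exact: rcoset_refl.
have cosetE' x (Gx : x \in G) (j : 'I_N) :
    exists i : 'I_N, forall k : 'I_N,
      ((transv j * x * (transv k)^-1)%g \in H) = (k == i).
  have [i defi] := cosetE (x^-1)%g (groupVr Gx) j; exists i => k.
  by rewrite -defi -groupV !invMg invgK mulgA.
apply/mx_dsummandP.
exists ((#|G : H|%:R^-1) *: \mxrow_(j < N) rG (transv j)^-1%g),
  (\mxcol_(j < N) rG (transv j)).
split=> [|x Gx|x Gx].
- rewrite -scalemxAl mul_mxrow_mxcol.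
  under eq_bigr => j _ do rewrite -repr_mxM ?groupV ?Gtr // mulVg repr_mx1.
  by rewrite sumr_const card_ord -scaler_nat scalerA mulVf ?scale1r.
- rewrite -scalemxAr -scalemxAl; congr (_ *: _).
  rewrite mul_mxrow mul_mxrow_mxblock; apply: eq_mxrow => j.
  have [i defi] := cosetE x Gx j.
  rewrite (bigD1 i) //= defi eqxx big1 ?addr0 => [|k neqk].
    by rewrite -!repr_mxM ?groupM ?groupV ?Gtr // !mulgA mulVg mul1g.
  by rewrite defi (negPf neqk) mulmx0.
rewrite mxcol_mul mul_mxblock_mxrow; apply: eq_mxcol => j.
have [i defi] := cosetE' x Gx j.
rewrite (bigD1 i) //= defi eqxx big1 ?addr0 => [|k neqk].
  by rewrite -!repr_mxM ?groupM ?groupV ?Gtr // mulgKV.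
by rewrite defi (negPf neqk) mul0mx.
Qed.

End RelativeProjectivity.

(** * Endomorphisms of indecomposable modules, and sums over orbits of cosets *)

Section Endomorphisms.

Variables (F : fieldType) (gT : finGroupType) (P : {group gT}).
Variables (d : nat) (rP : mx_representation F P d).

(* Fitting: the generalised kernel of an endomorphism has an invariant complement. *)
Lemma indecomposable_endo_unit (A : 'M[F]_d) (v : 'rV[F]_d) (b : F) :
  mx_indecomposable rP -> centgmx rP A ->
  v != 0 -> v *m A = b *: v -> b != 0 -> A \in unitmx.
Proof.
case=> d_gt0 indec cPA nz_v vA nz_b.
case: d d_gt0 rP A v indec cPA nz_v vA => // n _ rV A v indec cPA nz_v vA.
have [k [q q0 defA]] := multiplicity_XsubC (char_poly A) 0.
have {}q0 : ~~ root q 0 by apply: implyP q0 _; rewrite monic_neq0 ?char_poly_monic.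
rewrite subr0 in defA; have coX : coprimep q 'X by rewrite coprimepX.
have co : coprimep q ('X ^+ k) by rewrite coprimep_expr.
have modker p : mxmodule rV (kermxpoly A p).
  apply/mxmoduleP=> x Px; apply: comm_mx_stable_kermxpoly.
  exact: (centgmxP cPA).
have full : (kermxpoly A q + kermxpoly A ('X ^+ k) :=: 1%:M)%MS.
  apply: eqmx_trans (eqmx_sym (kermxpolyM A co)) _; rewrite -defA.
  by apply: kermxpoly_min; apply: mxminpoly_dvd_char.
have dx : mxdirect (kermxpoly A q + kermxpoly A ('X ^+ k)).
  by apply/mxdirect_addsP/mxdirect_kermxpoly.
have [q_0 | Xk_0] := indec _ _ (modker _) (modker _) full dx.
  (* Here [A] is nilpotent, against its nonzero eigenvalue [b]. *)
  have Xk1 : (1%:M <= kermxpoly A ('X ^+ k))%MS.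
    by rewrite -full q_0 adds0mx.
  have Ak0 : A ^+ k = 0.
    have /sub_kermxP := Xk1.
    by rewrite mul1mx rmorphXn /= horner_mx_X.
  have vAk j : v *m A ^+ j = b ^+ j *: v.
    elim: j => [|j IHj]; first by rewrite !expr0 mulmx1 scale1r.
    by rewrite exprSr -mulmxE mulmxA IHj -scalemxAl vA scalerA exprSr.
  have := vAk k; rewrite Ak0 mulmx0 => /esym/eqP.
  by rewrite scaler_eq0 (negPf nz_v) expf_eq0 (negPf nz_b) andbF.
have {}full : (1%:M <= kermxpoly A q)%MS by rewrite -full Xk_0 addsmx0.
rewrite -row_free_unit -kermx_eq0 -kermxpolyX -submx0.
by rewrite -(mxdirect_kermxpoly A coX) sub_capmx submx_refl (submx_trans (submx1 _)).
Qed.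

(** As [f] is nonzero, the image of [f *m e] is the line spanned by [e], and a commuting matrix
    preserves that image. *)
Lemma comm_rank1 (f : 'cV[F]_d) (e : 'rV[F]_d) (X : 'M_d) :
  f != 0 -> f *m e *m X = X *m (f *m e) -> exists b, e *m X = b *: e.
Proof.
move=> nz_f comX; have [i nz_fi] : exists i, f i 0 != 0.
  apply/existsP; apply: contraNT nz_f; rewrite negb_exists => /forallP f0.
  by apply/eqP/colP=> i; rewrite mxE; apply/eqP; have := f0 i; rewrite negbK.
exists ((f i 0)^-1 * (X *m f) i 0).
have rowE (g : 'cV[F]_d) : row i (g *m e) = g i 0 *: e.
  by apply/rowP=> j; rewrite !mxE big_ord1.
have := congr1 (row i) comX; rewrite mulmxA rowE row_mul rowE -scalemxAl.
by move/(canRL (scalerK nz_fi)); rewrite scalerA.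
Qed.

Section OrbitSums.

Variable a : {set gT} -> 'M[F]_d.
Hypothesis aJ : forall C x, x \in P -> a C *m rP x = rP x *m a (C :* x).

Definition orbit_sum (R : {group gT}) C := \sum_(C' in orbit 'Rs R C) a C'.

Lemma orbit_sum_comm (R : {group gT}) C x :
  R \subset P -> x \in R -> orbit_sum R C *m rP x = rP x *m orbit_sum R C.
Proof.
move=> sRP Rx; rewrite mulmx_suml mulmx_sumr.
have injx : injective (fun C' => C' :* x) by move=> C1 C2 /rcoset_inj.
rewrite [RHS](reindex_inj injx) /=.
apply: eq_big => [C' | C' _]; last by rewrite aJ ?(subsetP sRP).
by rewrite -rcosetE -[rcoset C' x]/('Rs%act C' x) orbit_actr.
Qed.

Lemma index2_quot (R : {group gT}) x g :
  R <| P -> #|P : R| = 2%N -> x \in P -> g \in P -> x \notin R -> g \notin R ->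
  (x * g^-1)%g \in R.
Proof.
move=> nsRP iRP Px Pg notRx notRg; have sRP := normal_sub nsRP.
have cardPR : #|P :\: R| = #|R|.
  by rewrite cardsD (setIidPr sRP) -(Lagrange sRP) iRP muln2 -addnn addnK.
have defD : R :* g = P :\: R.
  apply/eqP; rewrite eqEcard cardPR card_rcoset leqnn andbT.
  apply/subsetP=> _ /rcosetP[r Rr ->].
  by rewrite inE groupMl // notRg groupM // (subsetP sRP).
by rewrite -mem_rcoset defD inE notRx.
Qed.

(** Since [R] contains the stabiliser of [C], the [P]-orbit of [C] breaks into two [R]-orbits, and
    [g] carries one to the other. *)
Lemma orbit_sum_index2 (R : {group gT}) C g :
    R <| P -> #|P : R| = 2%N -> g \in P -> g \notin R ->
    'C_P[C | 'Rs] \subset R ->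
  orbit_sum P C
    = orbit_sum R C + rP g^-1%g *m orbit_sum R C *m rP g.
Proof.
move=> nsRP iRP Pg notRg sCR.
have injg : injective (fun C' => C' :* g) by move=> C1 C2 /rcoset_inj.
have -> : rP g^-1%g *m orbit_sum R C *m rP g
          = \sum_(C' in (fun C' => C' :* g) @: orbit 'Rs R C) a C'.
  rewrite big_imset /=; last by move=> ? ? _ _; apply: injg.
  rewrite -mulmxA mulmx_suml mulmx_sumr; apply: eq_bigr => C' _.
  by rewrite aJ // mulmxA -repr_mxM ?groupV // mulVg repr_mx1 mul1mx.
have sRP := normal_sub nsRP.
have orbE (Q : {group gT}) C' :
    reflect (exists2 x, x \in Q & C' = C :* x) (C' \in orbit 'Rs Q C).
  by apply: (iffP orbitP) => [[x Qx <-] | [x Qx ->]]; exists x => //=; rewrite rcosetE.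
rewrite -bigU /=.
  apply: eq_bigl => C'; rewrite !inE; apply/orbE/orP.
    case=> x Px ->; have [Rx | notRx] := boolP (x \in R).
      by left; apply/orbE; exists x.
    right; apply/imsetP; exists (C :* (x * g^-1)%g); last by rewrite -rcosetM mulgKV.
    by apply/orbE; exists (x * g^-1)%g; rewrite ?index2_quot.
  case=> [/orbE[x Rx ->] | /imsetP[_ /orbE[x Rx ->] ->]].
    by exists x; rewrite ?(subsetP sRP).
  by exists (x * g)%g; rewrite ?rcosetM // groupM // (subsetP sRP).
(* A common point C x = C y g would put y g x^-1 in the stabiliser of [C], hence in [R], and force
   [g] into [R]. *)
rewrite -setI_eq0; apply/eqP/setP=> C'; rewrite !inE; apply/andP.
case=> /orbE[x Rx ->] /imsetP[_ /orbE[y Ry ->]]; rewrite -rcosetM => eqC.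
case/negP: notRg.
suff : (y * g * x^-1)%g \in R by rewrite groupMr ?groupV // groupMl.
have Pxyg : (y * g * x^-1)%g \in P by rewrite groupMr ?groupV ?groupMr // (subsetP sRP).
apply: (subsetP sCR); rewrite inE Pxyg /=; apply/astab1P.
by rewrite /= rcosetE rcosetM -eqC -rcosetM mulgV mulg1.
Qed.

End OrbitSums.

(** Both [A] and the action of [g] commute with the transvection, so [e] is an eigenvector of each.
    Then [A] and its conjugate have the same eigenvalue b on [e], and 2b = 0. *)
Lemma index2_trace_annihilates (A : 'M[F]_d) f e t g :
    2%N \in [pchar F] -> f != 0 :> 'cV[F]_d -> rP t = 1%:M + f *m e ->
    t \in P -> g \in P -> A *m rP t = rP t *m A -> commute g t ->
  e *m (A + rP g^-1%g *m A *m rP g) = 0.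
Proof.
move=> F2 nz_f rPt Pt Pg comA comg.
have comf X : X *m rP t = rP t *m X -> exists b, e *m X = b *: e.
  rewrite rPt mulmxDl mulmxDr mulmx1 mul1mx => /addrI comX.
  by apply: comm_rank1 nz_f _.
have [b eA] := comf A comA.
have [|c eg] := comf (rP g^-1%g).
  by rewrite -!repr_mxM ?groupV // (commuteV (commute_sym comg)).
have egg : c *: (e *m rP g) = e.
  by rewrite scalemxAl -eg -mulmxA -repr_mxM ?groupV // mulVg repr_mx1 mulmx1.
have eAg : e *m (rP g^-1%g *m A *m rP g) = b *: e.
  by rewrite !mulmxA eg -!scalemxAl eA -scalemxAl scalerA mulrC -scalerA egg.
rewrite mulmxDr eA eAg -scalerDl -mulr2n -mulr_natl.
by rewrite (pcharf0 F2) mul0r scale0r.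
Qed.

(** As t is its own inverse, the sum expands as A + (1 + f e) A (1 + f e). The two copies of A
    cancel in characteristic 2, and each remaining term has f as left factor or e as right
    factor. *)
Lemma index2_trace_rank (A : 'M[F]_d) (f : 'cV[F]_d) (e : 'rV[F]_d) t :
    2%N \in [pchar F] -> rP t = 1%:M + f *m e -> (t * t = 1)%g ->
  (\rank (A + rP t^-1%g *m A *m rP t)%R <= 2)%N.
Proof.
move=> F2 rPt /(canRL (mulKg _)); rewrite mulg1 => <-.
rewrite rPt (_ : A + _ = f *m (e *m A) + (A *m f + f *m (e *m A *m f)) *m e); last first.
  rewrite !(mulmxDl, mulmxDr, mulmx1, mul1mx) !mulmxA !addrA.
  have -> : A + A = 0 by rewrite -mulr2n -scaler_nat (pcharf0 F2) scale0r.
  by rewrite add0r.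
apply: leq_trans (mxrank_add _ _) _; apply: (@leq_add _ _ 1 1).
  by apply: leq_trans (mxrankM_maxl _ _) (rank_leq_col _).
by apply: leq_trans (mxrankM_maxr _ _) (rank_leq_row _).
Qed.

End Endomorphisms.

(** * Excluding smaller vertices by means of transvections *)

Section VertexCriterion.

Variables (F : fieldType) (gT : finGroupType) (G P : {group gT}).
Hypotheses (sPG : P \subset G) (pP : 2.-group P) (F2 : 2%N \in [pchar F]).
Variables (d : nat) (rG : mx_representation F G d).

Definition transvection_on t := exists (f : 'cV[F]_d) (e : 'rV[F]_d),
  [/\ f != 0, e != 0 & rG t = 1%:M + f *m e].

Lemma vertex_of_transvections :
    mx_indecomposable (subg_repr rG sPG) -> (2 < d)%N ->
    (forall R : {group gT}, maximal R P -> exists t g,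
       [/\ t \in P, (t * t = 1)%g, transvection_on t & g \in P :\: R /\ commute g t]) ->
  forall (K : {group gT}) (sKP : K \subset P),
    rel_projective rG (subset_trans sKP sPG) -> K :=: P.
Proof.
move=> indecP d_gt2 genP K sKP /rel_projective_components[a sum_a aJ].
have [-> // | [R0 maxR0 sKR0]] := maximal_exists sKP.
have [t0 [_ [Pt0 _ [f0 [e0 [nz_f0 nz_e0 rt0]]] _]]] := genP R0 maxR0.
have ltKP : (#|K| < #|P|)%N.
  by apply: leq_ltn_trans (subset_leq_card sKR0) (proper_card (maxgroupp maxR0)).
have aJP C x : x \in P -> a C *m subg_repr rG sPG x = subg_repr rG sPG x *m a (C :* x).
  by move=> Px; apply: aJ; apply: (subsetP sPG).
have actX : [acts P, on rcosets K G | 'Rs].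
  exact: subset_trans sPG (actsRs_rcosets K G).
(* The orbit sums add up to the identity, so one of them does not kill [e0]. It commutes with [t0],
   so [e0] is an eigenvector with nonzero eigenvalue, and the orbit sum is invertible. *)
have [C XC nz_sum] : exists2 C, C \in rcosets K G & e0 *m orbit_sum a P C != 0.
  apply/exists_inP; apply: contraNT nz_e0; rewrite negb_exists_in => /forall_inP sum0.
  rewrite -[e0]mulmx1 -sum_a (set_partition_big _ (orbit_partition actX)) mulmx_sumr.
  rewrite big1 // => O /imsetP[C XC ->]; apply/eqP; rewrite -[_ == _]negbK; exact: sum0.
have cPs x : x \in P ->
    orbit_sum a P C *m subg_repr rG sPG x = subg_repr rG sPG x *m orbit_sum a P C.
  exact: orbit_sum_comm.
have unit_sum : orbit_sum a P C \in unitmx.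
  have [b e0b] : exists b, e0 *m orbit_sum a P C = b *: e0.
    apply: comm_rank1 nz_f0 _; apply/esym.
    by have := cPs t0 Pt0; rewrite /= rt0 mulmxDl mulmxDr mulmx1 mul1mx => /addrI.
  apply: (indecomposable_endo_unit indecP (introT centgmxP cPs) nz_e0 e0b).
  by apply: contraNneq nz_sum => b0; rewrite e0b b0 scale0r.
(* The stabiliser of a coset K x lies in the conjugate of [K] by x, which is smaller than [P]. *)
have stabC : 'C_P[C | 'Rs]%G \proper P.
  rewrite properE subsetIl /=; apply: contraL ltKP => sPC; rewrite -leqNgt.
  have /rcosetsP[x Gx defC] := XC; rewrite -(cardJg K x) subset_leq_card //.
  apply/subsetP=> y /(subsetP sPC)/setIP[Py /astab1P/=].
  rewrite rcosetE defC -rcosetM => /rcoset_eqP; rewrite mem_rcoset.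
  by rewrite mem_conjg conjgE invgK mulgA.
have [eqC | [R maxR sCR]] := maximal_exists (proper_sub stabC).
  by rewrite eqC properxx in stabC.
have [t [g [Pt t2 [f [e [nz_f nz_e rt]]] [/setDP[Pg notRg] cgt]]]] := genP R maxR.
have nsRP := p_maximal_normal pP maxR; have iRP := p_maximal_index pP maxR.
have sRP := normal_sub nsRP.
(* If t lies in [R], the invertible orbit sum kills e; if not, t can serve as the element outside
   [R], and the orbit sum has rank at most 2. *)
have [Rt | notRt] := boolP (t \in R).
  have [] := negP nz_e; rewrite -(mulmxK unit_sum e).
  rewrite (orbit_sum_index2 aJP nsRP iRP Pg notRg sCR).
  rewrite (index2_trace_annihilates (rP := subg_repr rG sPG) F2 nz_f rt) ?mul0mx //.
  exact: orbit_sum_comm.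
have := index2_trace_rank (rP := subg_repr rG sPG) (orbit_sum a R C) F2 rt t2.
rewrite -(orbit_sum_index2 aJP nsRP iRP Pt notRt sCR) mxrank_unit //.
by rewrite leqNgt d_gt2.
Qed.

End VertexCriterion.

(** * Sylow 2-subgroups of symmetric groups *)

Section SylowSymmetric.

Variable n : nat.
Implicit Types (P R : {group 'S_n}) (i j : 'I_n).

Lemma even_matching : ~~ odd n ->
  exists2 s : 'I_n -> 'I_n, involutive s & forall i, s i != i.
Proof.
move=> even_n; pose k m := if odd m then m.-1 else m.+1.
have kK m : k (k m) = m.
  by rewrite /k; case: m => //= m; case odd_m: (odd m); rewrite /= odd_m.
have k_neq m : k m != m.
  by rewrite /k; case: m => //= m; case: (odd m); rewrite /= neq_ltn leqnn ?orbT.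
(* The map [k] swaps 2m and 2m+1. It stays below [n] because, [n] being even, the last index is
   odd. *)
have k_lt (i : 'I_n) : (k i < n)%N.
  rewrite /k; case: ifPn => odd_i; first exact: leq_ltn_trans (leq_pred i) _.
  by rewrite ltn_neqAle ltn_ord andbT; apply: contraNneq even_n => <-.
exists (fun i => Ordinal (k_lt i)) => i; last exact: k_neq.
by apply: val_inj; apply: kK.
Qed.

(* The permutations moving each point within its pair form an elementary      *)
(* abelian 2-group, which some Sylow 2-subgroup contains.                      *)
Lemma Sylow2_matching P : ~~ odd n -> (2.-Sylow([set: 'S_n]) P)%g ->
  exists tau : 'I_n -> 'I_n, [/\ involutive tau, forall i, tau i != i
    & forall i, tperm i (tau i) \in P].
Proof.
move=> even_n sylP; have [s sK s_neq] := even_matching even_n.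
pose E := [set x : 'S_n | [forall i, (x i == i) || (x i == s i)]].
have EP (x : 'S_n) : reflect (forall i, x i = i \/ x i = s i) (x \in E).
  rewrite inE; apply: (iffP forallP) => Ex i; first by case/orP: (Ex i) => /eqP; auto.
  by case: (Ex i) => ->; rewrite eqxx ?orbT.
have gE : group_set E.
  apply/group_setP; split=> [|x y /EP Ex /EP Ey]; apply/EP=> i.
    by rewrite perm1; left.
  rewrite permM; case: (Ex i) => ->; first exact: Ey.
  by case: (Ey (s i)) => ->; rewrite ?sK; auto.
have sqE (x : 'S_n) : x \in E -> (x ^+ 2 = 1)%g.
  move=> /EP Ex; apply/permP=> i; rewrite perm1 expgS expg1 permM.
  case: (Ex i) => xi; rewrite xi //; case: (Ex (s i)) => xsi; rewrite xsi ?sK //.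
  by have := s_neq i; rewrite (perm_inj (etrans xsi (esym xi))) eqxx.
have pE : (2.-group (Group gE))%g.
  apply/pgroupP=> p pr_p /(Cauchy pr_p)[x Ex ox]; rewrite inE -dvdn_prime2 // -ox.
  by rewrite order_dvdn; apply/eqP/sqE.
have [Q sylQ sEQ] := Sylow_superset (subsetT (Group gE)) pE.
(* The matching for [P] is [s] transported by the permutation conjugating [Q] to [P]. *)
have [x _ defP] := Sylow_trans sylQ sylP.
exists (fun i => x (s (x^-1%g i))); split=> [i | i | i].
- by rewrite permK sK permKV.
- by apply: contra (s_neq (x^-1%g i)) => /eqP xs; rewrite -{2}xs permK.
rewrite defP -{1}[i](permKV x) -tpermJ memJ_conjg; apply: (subsetP sEQ).
apply/EP=> j; case: tpermP => [-> | -> |]; auto; by rewrite sK; right.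
Qed.

(** If [P] were transitive, n would divide the order of [P], a power of 2. *)
Lemma Sylow2_intransitive P : (0 < n)%N -> (2.-Sylow([set: 'S_n]) P)%g ->
    ~ (exists k : nat, n = (2 ^ k)%N) ->
  forall i, exists j, j \notin orbit 'P P i.
Proof.
move=> n_gt0 sylP not2 i; apply/existsP; rewrite -negb_forall; apply/negP => /forallP trP.
have orbT : orbit 'P P i = [set: 'I_n].
  by apply/setP=> j; rewrite inE; apply/idP; have := trP j; rewrite ?negbK.
have dvd : (n %| #|P|)%N by rewrite -{1}[n]card_ord -cardsT -orbT dvdn_orbit.
apply: not2; have [k _ eqn] : exists2 k, (k <= logn 2 #|P|)%N & n = (2 ^ k)%N.
  by apply/dvdn_pfactor; rewrite // -(card_pgroup (pHall_pgroup sylP)).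
by exists k.
Qed.

(** The restrictions of [P] to [S] and to its complement commute, so they generate a p-group; it
    contains [P], and equals it by maximality. *)
Lemma restr_perm_Sylow P (p : nat) (S : {set 'I_n}) :
    (p.-Sylow([set: 'S_n]) P)%g -> P \subset ('N(S | 'P))%g ->
  forall g, g \in P ->
    [/\ restr_perm S g \in P, restr_perm (~: S) g \in P
      & (restr_perm S g * restr_perm (~: S) g)%g = g].
Proof.
move=> sylP nSP g Pg; set S' := ~: S; have nS'P : P \subset ('N(S' | 'P))%g.
  by rewrite astabsC.
have nSg := subsetP nSP g Pg; have nS'g := subsetP nS'P g Pg.
have offS (T : {set 'I_n}) x i : i \notin T -> restr_perm T x i = i.
  by apply: out_perm; apply: restr_perm_on.
have defg x : x \in P -> (restr_perm S x * restr_perm S' x)%g = x.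
  move=> Px; have nSx := subsetP nSP x Px; apply/permP=> i; rewrite permM.
  have [Si | notSi] := boolP (i \in S).
    rewrite (restr_permE nSx) // offS // !inE negbK.
    by rewrite -[x i]/('P%act i x) (astabs_act _ nSx).
  by rewrite (offS S) // restr_permE ?(subsetP nS'P) // in_setC.
have commS x y : commute (restr_perm S x) (restr_perm S' y).
  apply/permP=> i; rewrite !permM.
  have on_S := restr_perm_on S x; have on_S' := restr_perm_on S' y.
  have [Si | notSi] := boolP (i \in S).
    rewrite [restr_perm S' y i]offS ?inE ?negbK // offS // inE negbK.
    by rewrite (perm_closed _ on_S).
  rewrite [restr_perm S x i]offS // [RHS]offS // -in_setC.
  by rewrite (perm_closed _ on_S') inE.
pose Q := [group of restr_perm S @* P <*> restr_perm S' @* P].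
have cQ : restr_perm S @* P \subset 'C(restr_perm S' @* P).
  apply/centsP=> _ /morphimP[x _ _ ->] _ /morphimP[y _ _ ->]; exact: commS.
have pQ : p.-group Q.
  by rewrite /= cent_joinEl // pgroupM !morphim_pgroup // (pHall_pgroup sylP).
have sPQ : P \subset Q.
  apply/subsetP=> x Px; rewrite -(defg x Px) groupM // ?mem_gen // inE.
    by rewrite mem_morphim // (subsetP nSP).
  by rewrite orbC mem_morphim // (subsetP nS'P).
have defQ := sub_pHall sylP pQ sPQ (subsetT Q).
split; last exact: defg.
  by rewrite -defQ mem_gen // inE mem_morphim.
by rewrite -defQ mem_gen // inE orbC mem_morphim.
Qed.

(** Take an element of [P] outside [R] and split it along an orbit [S] of [P] and its complement.
    Both factors are in [P] and one is outside [R]. That factor fixes the other part pointwise,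
    hence commutes with the matching transpositions there. *)
Lemma Sylow2_generated_by_centralizers P R (tau : 'I_n -> 'I_n) :
    (0 < n)%N -> ~ (exists k : nat, n = (2 ^ k)%N) ->
    (2.-Sylow([set: 'S_n]) P)%g -> (forall i, tperm i (tau i) \in P) ->
    R \proper P ->
  exists i g, g \in P :\: R /\ commute g (tperm i (tau i)).
Proof.
move=> n_gt0 not2 sylP tauP /properP[_ [g Pg notRg]].
pose i : 'I_n := Ordinal n_gt0; pose S := orbit 'P P i.
have [j notSj] := Sylow2_intransitive n_gt0 sylP not2 i.
have nSP : P \subset ('N(S | 'P))%g by apply: acts_orbit; apply: subsetT.
have tauS k : (tau k \in S) = (k \in S).
  rewrite -{1}(tpermL k (tau k)) -[tperm k _ k]/('P%act k (tperm k (tau k))).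
  by rewrite (astabs_act _ (subsetP nSP _ (tauP k))).
have [PgS PgS' defg] := restr_perm_Sylow sylP nSP Pg.
have comm_off (T : {set 'I_n}) k :
    k \notin T -> tau k \notin T -> commute (restr_perm T g) (tperm k (tau k)).
  move=> notTk notTtk; apply/commute_sym/commgP/conjg_fixP; rewrite tpermJ.
  by rewrite !(out_perm (restr_perm_on T g)).
have [RgS | notRgS] := boolP (restr_perm S g \in R).
  exists i, (restr_perm (~: S) g); split; last first.
    by apply: comm_off; rewrite inE negbK ?tauS orbit_refl.
  rewrite inE PgS' andbT; apply: contra notRg => RgS'.
  by rewrite -defg groupM.
exists j, (restr_perm S g); split; first by rewrite inE notRgS.
by apply: comm_off; rewrite ?tauS.
Qed.

End SylowSymmetric.

(** * The natural simple module *)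

Section NaturalModule.

Variables (F : fieldType) (n : nat).
Hypotheses (F2 : 2%N \in [pchar F]) (n_gt2 : (2 < n)%N).

Let M' := augmentation_mx F n.
Let M'' := trivial_line_mx F n.
Let D := natural_simple_repr F n.
Let d := \rank <<in_factmod M'' M'>>%MS.

(* The class in D = M' / M'' of each row of v; meaningless off M'.             *)
Definition natural_class m (v : 'M[F]_(m, n)) : 'M[F]_(m, d) :=
  in_submod <<in_factmod M'' M'>>%MS (in_factmod M'' v).

Local Notation class := natural_class.
Local Notation edge i j := (delta_mx 0 i + delta_mx 0 j : 'rV[F]_n).

Lemma natural_class_mul m k (A : 'M_(m, k)) (v : 'M_(k, n)) :
  class (A *m v) = A *m class v.
Proof.
by rewrite /natural_class /in_submod /in_factmod /= !(mulmxA A).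
Qed.

Lemma natural_classD m (u v : 'M_(m, n)) : class (u + v) = class u + class v.
Proof. by rewrite /natural_class !linearD. Qed.

Lemma natural_class0 m : class (0 : 'M_(m, n)) = 0.
Proof. by rewrite -[X in class X](mul0mx m (0 : 'M_(m, n))) natural_class_mul mul0mx. Qed.

Lemma natural_class_eq0 m (v : 'M_(m, n)) :
  (v <= M')%MS -> (class v == 0) = (v <= M'')%MS.
Proof.
move=> M'v; rewrite -in_factmod_eq0 -[LHS]val_submod_eq0 in_submodK // genmxE.
exact: submxMr.
Qed.

Lemma natural_classJ m (v : 'M_(m, n)) (s : 'S_n) :
  (v <= M')%MS -> class v *m D s = class (v *m perm_mx s).
Proof.
move=> M'v; rewrite /natural_class (in_factmodJ (trivial_line_module F n)) ?inE //.
rewrite (in_submodJ (section_module _ (augmentation_module F n))) // genmxE.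
exact: submxMr.
Qed.

Lemma natural_class_lift m (w : 'M_(m, d)) :
  exists2 v : 'M_(m, n), (v <= M')%MS & class v = w.
Proof.
have := val_submodP w; rewrite genmxE => /submxP[X defw].
exists (X *m M'); first exact: submxMl.
rewrite natural_class_mul /natural_class in_submodE mulmxA -defw -in_submodE.
exact: val_submodK.
Qed.

Lemma sub_augmentation m (v : 'M_(m, n)) :
  (v <= M')%MS = (v *m (const_mx 1 : 'cV_n) == 0).
Proof. exact: (sameP sub_kermxP eqP). Qed.

Lemma sub_trivial_line m (v : 'M_(m, n)) :
  (v <= M'')%MS = (v <= (const_mx 1 : 'rV_n))%MS.
Proof. by rewrite genmxE. Qed.

Lemma edge_augmentation i j : (edge i j <= M')%MS.
Proof.
rewrite sub_augmentation; apply/eqP/matrixP=> a b; rewrite mulmxDl !mxE.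
rewrite (bigD1 i) //= big1 => [|k neqk]; last by rewrite !mxE (negPf neqk) andbF mul0r.
rewrite (bigD1 j) //= big1 => [|k neqk]; last by rewrite !mxE (negPf neqk) andbF mul0r.
by rewrite !mxE !ord1 !eqxx /= !mulr1 !addr0 -mulr2n (pcharf0 F2).
Qed.

Lemma third_point i j : i != j -> exists2 k : 'I_n, k != i & k != j.
Proof.
move=> neq_ij; suff /existsP[k /andP[]] : [exists k, (k != i) && (k != j)] by exists k.
apply: contraLR n_gt2; rewrite negb_exists -leqNgt => /forallP all2.
have : #|[set i; j]| = 2%N by rewrite cards2 neq_ij.
suff -> : [set i; j] = [set: 'I_n] by rewrite cardsT card_ord => ->.
by apply/setP=> k; rewrite !inE -[RHS](all2 k) negb_and !negbK.
Qed.

Lemma edge_class_neq0 i j : i != j -> class (edge i j) != 0.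
Proof.
move=> neq_ij; rewrite natural_class_eq0 ?edge_augmentation // sub_trivial_line.
apply/negP=> /submxP[c /rowP eq_c].
have [k neq_ki neq_kj] := third_point neq_ij.
have := eq_c k; have := eq_c i; rewrite !mxE !big_ord1 !mxE !eqxx /=.
rewrite (negPf neq_ki) (negPf neq_kj) (negPf neq_ij) /= => <- /eqP.
by rewrite !addr0 eq_sym oner_eq0.
Qed.

(** A transposition is the reflection in gamma_i - gamma_j, and signs disappear in characteristic
    2. *)
Lemma tperm_mx_char2 i j : i != j ->
  tperm_mx i j = 1%:M + (edge i j)^T *m edge i j.
Proof.
move=> neq_ij; apply/matrixP=> a b; rewrite !mxE big_ord1 !mxE !eqxx /=.
have double (x : F) : x + x = 0 by rewrite -mulr2n -mulr_natl (pcharf0 F2) mul0r.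
have [-> | neq_ai] := eqVneq a i.
  by rewrite tpermL (negPf neq_ij) addr0 mul1r ![_ == b]eq_sym addrA double add0r.
have [-> | neq_aj] := eqVneq a j.
  by rewrite tpermR add0r mul1r ![_ == b]eq_sym addrCA double addr0.
by rewrite tpermD 1?eq_sym // add0r mul0r addr0.
Qed.

Lemma natural_class_tperm i j (v : 'rV_n) : i != j -> (v <= M')%MS ->
  class v *m D (tperm i j) = class v + (v 0 i + v 0 j) *: class (edge i j).
Proof.
move=> neq_ij M'v; rewrite natural_classJ // [perm_mx _](tperm_mx_char2 neq_ij).
rewrite mulmxDr mulmx1 mulmxA natural_classD natural_class_mul; congr (_ + _).
rewrite -mul_scalar_mx; congr (_ *m _); apply/matrixP=> a b; rewrite !ord1.
by rewrite linearD /= !trmx_delta mulmxDr -!colE !mxE mulr1n.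
Qed.

Lemma natural_tperm_neq1 i j : i != j -> D (tperm i j) <> 1%:M.
Proof.
move=> neq_ij Dij; have [k neq_ki neq_kj] := third_point neq_ij.
have := natural_class_tperm neq_ij (edge_augmentation i k).
rewrite Dij mulmx1 -{1}[class _]addr0 => /addrI/esym/eqP.
rewrite !mxE !eqxx /= (eq_sym i k) (eq_sym j i) (eq_sym j k).
rewrite (negPf neq_ki) (negPf neq_kj) (negPf neq_ij) /= !addr0 scale1r.
by rewrite (negPf (edge_class_neq0 neq_ij)).
Qed.

Lemma natural_transvection i j : i != j ->
  exists2 f : 'cV_d, f != 0 & D (tperm i j) = 1%:M + f *m class (edge i j).
Proof.
(* The rows of [L] lift a basis of D, so the column [f] lists the values of v_i + v_j on that
   basis. *)
move=> neq_ij; have [L M'L classL] := natural_class_lift 1%:M.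
have Dij : D (tperm i j) = 1%:M + L *m (edge i j)^T *m class (edge i j).
  rewrite -[LHS]mul1mx -classL natural_classJ //.
  rewrite [perm_mx _](tperm_mx_char2 neq_ij) mulmxDr mulmx1 mulmxA.
  by rewrite natural_classD natural_class_mul classL.
exists (L *m (edge i j)^T) => //; apply: contra_eq_neq Dij => ->.
by rewrite mul0mx addr0; apply/eqP/natural_tperm_neq1.
Qed.

Lemma natural_dim_gt2 : (4 < n)%N -> (2 < d)%N.
Proof.
move=> n_gt4; have := mxrank_in_factmod M'' M'.
rewrite -[d]/(\rank <<in_factmod M'' M'>>%MS) genmxE => eq_d.
have rM'' : (\rank M'' <= 1)%N by rewrite genmxE rank_leq_row.
have rM' : (n.-1 <= \rank (M'' + M'))%N.
  apply: leq_trans (mxrankS (addsmxSr M'' M')).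
  by rewrite mxrank_ker -subn1 leq_sub2l // rank_leq_col.
rewrite -(leq_add2r 1); apply: leq_trans (leq_add (leqnn _) rM'').
by rewrite eq_d (leq_trans _ rM') // -subn1 ltn_subRL.
Qed.

(** * Submodules for a group containing a perfect matching of transpositions *)

Section Matching.

Variables (P : {group 'S_n}) (tau : 'I_n -> 'I_n).
Hypotheses (tauK : involutive tau) (tau_neq : forall i, tau i != i).
Hypothesis tauP : forall i, tperm i (tau i) \in P.

Local Notation DP := (subg_repr D (subsetT P)).
Local Notation e i := (class (edge i (tau i))).

(** The difference u t - u lies in [U] and is a multiple of the edge class. *)
Lemma tperm_fix_or_edge (U : 'M_d) (u : 'rV_d) i :
    mxmodule DP U -> (u <= U)%MS ->
  u *m D (tperm i (tau i)) = u \/ (e i <= U)%MS.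
Proof.
move=> modU Uu; have [v M'v defu] := natural_class_lift u.
have neq_i : i != tau i by rewrite eq_sym.
have ut := natural_class_tperm neq_i M'v; rewrite defu in ut.
have [v0 | nz_v] := eqVneq (v 0 i + v 0 (tau i)) 0.
  by left; rewrite ut v0 scale0r addr0.
right; rewrite -(eqmx_scale _ nz_v).
have -> : (v 0 i + v 0 (tau i)) *: e i = u *m D (tperm i (tau i)) - u.
  by rewrite ut [RHS]addrC addKr.
by rewrite addmx_sub ?eqmx_opp // (mxmodule_trans modU (tauP i)).
Qed.

Lemma class_pair_constant (v : 'rV_n) (U : 'M_d) :
    (forall i, v 0 i = v 0 (tau i)) -> (forall i, v 0 i != 0 -> (e i <= U)%MS) ->
  (v <= M')%MS /\ (class v <= U)%MS.
Proof.
move=> v_tau eU.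
(* The condition [i < tau i] picks one point from each pair. *)
have -> : v = \sum_(i < n | (i < tau i)%N) v 0 i *: edge i (tau i).
  apply/rowP=> j; rewrite summxE.
  have [lt_j | le_j] := ltnP j (tau j).
    rewrite (bigD1 j) //= big1 ?addr0 => [|i /andP[lt_i neq_ij]].
      by rewrite !mxE !eqxx /= eq_sym (negPf (tau_neq j)) addr0 mulr1.
    rewrite !mxE !eqxx /= eq_sym (negPf neq_ij) (_ : (j == tau i) = false).
      by rewrite addr0 mulr0.
    by apply: contraTF lt_j => /eqP->; rewrite tauK -leqNgt ltnW.
  have lt_j : (tau j < tau (tau j))%N.
    by rewrite tauK ltn_neqAle le_j andbT val_eqE tau_neq.
  rewrite (bigD1 (tau j)) //= big1 ?addr0 => [|i /andP[lt_i neq_ij]].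
    by rewrite !mxE !eqxx /= tauK eqxx eq_sym (negPf (tau_neq j)) add0r mulr1.
  have neq_ji : j != i by apply: contraTneq lt_i => <-; rewrite -leqNgt.
  have neq_jti : j != tau i by apply: contraNneq neq_ij => ->; rewrite tauK.
  by rewrite !mxE /= (negPf neq_ji) (negPf neq_jti) addr0 mulr0.
split.
  by rewrite summx_sub // => i _; rewrite scalemx_sub ?edge_augmentation.
rewrite (big_morph (@natural_class 1) (@natural_classD 1) (natural_class0 1)).
apply: summx_sub => i _.
have [-> | nz_vi] := eqVneq (v 0 i) 0; first by rewrite scale0r natural_class0 sub0mx.
by rewrite -mul_scalar_mx natural_class_mul mul_scalar_mx scalemx_sub // eU.
Qed.

(** No edge class lies in [W], so the matching fixes [W] pointwise. Lifts of fixed vectors are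
    constant on pairs, hence their classes are combinations of edge classes and lie in [U]. *)
Lemma complement_of_edges (U W : 'M_d) :
    mxmodule DP W -> (U :&: W = 0)%MS -> (forall i, e i <= U)%MS -> W = 0.
Proof.
move=> modW dx eU; apply/eqP; rewrite -submx0 -dx sub_capmx submx_refl andbT.
apply/row_subP=> k; set w := row k W; have Ww : (w <= W)%MS by apply: row_sub.
have [v M'v defw] := natural_class_lift w; rewrite -defw.
suff v_tau i : v 0 i = v 0 (tau i).
  by have [] := class_pair_constant v_tau (fun i _ => eU i).
have neq_i : i != tau i by rewrite eq_sym.
have nz_e := edge_class_neq0 neq_i.
have [wt | We] := tperm_fix_or_edge i modW Ww; last first.
  by case/negP: nz_e; rewrite -submx0 -dx sub_capmx eU.
have := natural_class_tperm neq_i M'v; rewrite defw wt -{1}[w]addr0 => /addrI/esym/eqP.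
rewrite scaler_eq0 (negPf nz_e) orbF => /eqP v0.
by apply/eqP; rewrite -subr_eq0 -[- _](oppr_pchar2 F2) opprK v0.
Qed.

Lemma natural_indecomposable : (0 < d)%N -> mx_indecomposable DP.
Proof.
move=> d_gt0; split=> // U W modU modW defUW dxUW.
have dx : (U :&: W = 0)%MS by apply/mxdirect_addsP.
have dx' : (W :&: U = 0)%MS by rewrite capmxC.
have neq_i i : i != tau i by rewrite eq_sym.
(* If neither summand contained the edge class, the transposition would fix both and act trivially
   on D. *)
have eUW i : (e i <= U)%MS \/ (e i <= W)%MS.
  have [|notU] := boolP (e i <= U)%MS; first by left.
  have [|notW] := boolP (e i <= W)%MS; first by right.
  case: (natural_tperm_neq1 (neq_i i)); apply/row_matrixP=> k.
  rewrite row1 rowE.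
  have /sub_addsmxP[[a b] /= ->] : ((delta_mx 0 k : 'rV_d) <= U + W)%MS.
    by rewrite defUW submx1.
  have [aU | ] := tperm_fix_or_edge i modU (submxMl a U); last by rewrite (negPf notU).
  have [bW | ] := tperm_fix_or_edge i modW (submxMl b W); last by rewrite (negPf notW).
  by rewrite mulmxDl aU bW.
pose A := [pred i | (e i <= U)%MS].
have eC i : e (tau i) = e i by rewrite tauK addrC.
pose ind (B : pred 'I_n) := \row_(i < n) (i \in B)%:R : 'rV[F]_n.
have [|i /[!mxE]| M'A UA] := @class_pair_constant (ind A) U.
- by move=> i; rewrite !mxE !inE eC.
- by rewrite inE; case: (e i <= U)%MS; rewrite ?eqxx.
have [|i /[!mxE]| M'B WB] := @class_pair_constant (ind (predC A)) W.
- by move=> i; rewrite !mxE !inE eC.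
- by rewrite !inE; case: (eUW i) => ->; rewrite ?eqxx.
(* The two indicators add up to the all-ones vector, which vanishes in D. Hence the class of [ind A]
   lies in both summands and is zero, so [ind A] is constant: [A] is empty or everything. *)
have sumAB : class (ind A) = - class (ind (predC A)).
  apply/eqP; rewrite -addr_eq0 -natural_classD natural_class_eq0.
    rewrite (_ : _ + _ = const_mx 1) ?sub_trivial_line //.
    apply/rowP=> i; rewrite !mxE !inE /=.
    by case: (e i <= U)%MS; rewrite ?addr0 ?add0r.
  exact: addmx_sub.
have : (class (ind A) <= (0 : 'M_d))%MS by rewrite -dx sub_capmx UA sumAB eqmx_opp.
rewrite submx0 natural_class_eq0 // sub_trivial_line => /submxP[c /rowP eq_c].
have indA i : (i \in A)%:R = c 0 0 :> F.
  by have := eq_c i; rewrite !mxE big_ord1 mxE mulr1.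
have [c0 | nz_c] := eqVneq (c 0 0) 0.
  left; apply: (complement_of_edges modU dx') => i.
  have := indA i; rewrite c0; have [eU | ] := eUW i; last by [].
  by rewrite inE eU => /eqP; rewrite oner_eq0.
right; apply: (complement_of_edges modW dx) => i.
by have := indA i; rewrite inE; case: (e i <= U)%MS => // /esym/eqP; rewrite (negPf nz_c).
Qed.

End Matching.

End NaturalModule.

Theorem theorem9p1 (F : closedFieldType) (n : nat) (P : {group 'S_n}) :
  2%N \in [pchar F] -> (0 < n)%N -> ~~ odd n -> ~ (exists k : nat, n = (2 ^ k)%N) ->
  (2.-Sylow([set: 'S_n]) P)%g ->
  has_vertex_source (natural_simple_repr F n) (subsetT P)
    (subg_repr (natural_simple_repr F n) (subsetT P)).
Proof.
move=> F2 n_gt0 even_n not2 sylP.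
(* Both 2 and 4 are powers of 2; beyond them dim D exceeds 2, the rank bound of
   [index2_trace_rank]. *)
have n_gt4 : (4 < n)%N.
  case: n P n_gt0 even_n not2 sylP => [|[|[|[|[|m]]]]] //= P _ _ not2 _.
    by case: not2; exists 1%N.
  by case: not2; exists 2%N.
have n_gt2 : (2 < n)%N by apply: leq_trans n_gt4.
have d_gt2 := natural_dim_gt2 F n_gt4.
have [tau [tauK tau_neq tauP]] := Sylow2_matching even_n sylP.
have indecP : mx_indecomposable (subg_repr (natural_simple_repr F n) (subsetT P)).
  by apply: natural_indecomposable F2 n_gt2 _ _ tauK tau_neq tauP (ltnW (ltnW d_gt2)).
have summand : mx_dsummand (natural_simple_repr F n)
    (induced_repr (subsetT P) (subg_repr (natural_simple_repr F n) (subsetT P))).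
  apply: dsummand_induced_restriction.
  rewrite -(dvdn_pcharf F2) -p'natE //; by case/and3P: sylP.
split=> //; split; first exact: indecomposable_of_subg indecP.
  by exists _, (subg_repr (natural_simple_repr F n) (subsetT P)).
move=> K sKP; have vertexP := vertex_of_transvections (pHall_pgroup sylP) F2 indecP d_gt2.
apply: vertexP => R maxR.
have [i [g [PRg cgt]]] := Sylow2_generated_by_centralizers n_gt0 not2 sylP tauP
  (maxgroupp maxR).
have neq_i : i != tau i by rewrite eq_sym.
have [f nz_f rt] := natural_transvection F2 n_gt2 neq_i.
exists (tperm i (tau i)), g; split; rewrite ?tauP ?tperm2 //.
exists f, (natural_class (delta_mx 0 i + delta_mx 0 (tau i))); split=> //.
exact: edge_class_neq0 F2 n_gt2 _ _ neq_i.
Qed.
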